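(* Let $p>3$ and let $\bar H$ be an ordinary CY3 crystal over $\bar A_0$ such that the map $T_{\bar A/\bar W}\to\mathrm{Hom}(\bar H^3,\bar H^2)$ induced by $\nabla$ is an isomorphism (so $n=h$). Let $e_0,\ldots,e_{2h+1}$, $\mathcal T$, $Z$ and $\tau_1,\ldots,\tau_h$ be an adapted basis with its matrix and components as described in the context. Then for all $i,j,k\in\{1,\ldots,h\}$ $$\left\langle e_{2h+1},\ \nabla\!\left(\frac{\partial^3}{\partial\tau_i\partial\tau_j\partial\tau_k}\right)e_{2h+1}\right\rangle=-\frac12\,\frac{\partial^3Z}{\partial\tau_i\partial\tau_j\partial\tau_k},$$ where $\nabla\!\left(\frac{\partial^3}{\partial\tau_i\partial\tau_j\partial\tau_k}\right)$ is shorthand for $\left(\frac{\partial}{\partial\tau_i}\otimes1\right)\circ\nabla\circ\left(\frac{\partial}{\partial\tau_j}\otimes1\right)\circ\nabla\circ\left(\frac{\partial}{\partial\tau_k}\otimes1\right)\circ\nabla$.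
   Context: Rings. $p$ is a prime, $\bar k$ an algebraically closed field of characteristic $p$, $\bar W$ its ring of Witt vectors, $K^{\mathrm u}=\bar W[1/p]$, $\sigma$ the Frobenius automorphism of $\bar W$ (lifting $x\mapsto x^p$ on $\bar k$), $\bar A_0=\bar k[[t_1,\ldots,t_n]]$, $\bar A=\bar W[[t_1,\ldots,t_n]]$. $\Omega^1_{\bar A/\bar W}$ denotes the module of (continuous) differentials, free over $\bar A$ on $dt_1,\ldots,dt_n$; $T_{\bar A/\bar W}=\mathrm{Hom}(\Omega^1_{\bar A/\bar W},\bar A)$. A lift of Frobenius is a ring endomorphism $\phi$ of $\bar A$ that restricts to $\sigma$ on $\bar W$ and reduces modulo $p$ to $x\mapsto x^p$ on $\bar A_0$. For an $\bar A$-module $H$, $\phi^*H=\bar A\otimes_{\phi,\bar A}H$ and $\phi^*:H\to\phi^*H$, $h\mapsto 1\otimes h$, is $\phi$-linear. Crystals. A crystal over $\bar A_0$ is a finitely generated free $\bar A$-module $H$ with a connection $\nabla:H\to\Omega^1_{\bar A/\bar W}\otimes_{\bar A} H$ such that the operators $D_i=(\frac{d}{dt_i}\otimes1)\circ\nabla$ satisfy $D_iD_j=D_jD_i$ and $\lim_{m\to\infty}D_i^m=0$ in the $p$-adic topology of $\mathrm{End}_{\bar W}(H)$. For two lifts of Frobenius $\phi,\psi$ there is a canonical isomorphism $\chi(\phi,\psi):\phi^*H\to\psi^*H$ given by $$\chi(\phi,\psi)\phi^*(x)=\sum_{m_1,\ldots,m_n\ge0}\ \prod_{j=1}^n\frac{p^{m_j}}{m_j!}\Big(\frac{\phi(t_j)-\psi(t_j)}{p}\Big)^{m_j}\psi^*(D_1^{m_1}\circ\cdots\circ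 D_n^{m_n}(x)).$$ $F$-crystals. An $F$-crystal over $\bar A_0$ is a crystal $(H,\nabla)$ together with, for every lift of Frobenius $\phi$, an $\bar A$-linear map $F(\phi):\phi^*H\to H$ such that: $\nabla\circ F(\phi)\phi^*=(\phi\otimes F(\phi)\phi^* )\circ\nabla$, where $\phi(b\,da)=\phi(b)\,d(\phi(a))$ on forms; $F(\psi)\circ\chi(\phi,\psi)=F(\phi)$ for all lifts $\phi,\psi$; and $F(\phi)\otimes\mathbb Q_p$ is an isomorphism. It is a unit $F$-crystal if $F(\phi)$ is an isomorphism for one (equivalently every) $\phi$. For a unit $F$-crystal $V$, the Tate twist $V(-i)$ is the same module with connection, with $F(\phi)\phi^*$ replaced by $p^iF(\phi)\phi^*$. Filtrations. Let $H_0=H\otimes_{\bar A}\bar A_0$. Put $\mathrm{Fil}_iH_0=\{x\in H_0\mid \exists y\in H\text{ lifting }x\text{ with }p^iy\in\mathrm{Im}\,F(\phi)\}$ (conjugate filtration) and $\mathrm{Fil}^iH_0=\{x\in H_0\mid\exists y\in H\text{ lifting }x\text{ with }F(\phi)\phi^*y\in p^iH\}$ (Hodge filtration); these are independent of $\phi$. $H$ is of level $\le N$ if $\mathrm{Fil}_NH_0=H_0$ and $\mathrm{Fil}^{N+1}H_0=0$. A Hodge $F$-crystal over $\bar A_0$ is an $F$-crystal $H$ with a decreasing filtration $H=\mathrm{Fil}^0H\supset\mathrm{Fil}^1H\supset\cdots$ by free $\bar A$-submodules such that for all $i$: $\mathrm{Fil}^iH\otimes_{\bar A}\bar A_0=\mathrm{Fil}^iH_0$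 (via the natural map to $H_0$) and $\nabla\mathrm{Fil}^iH\subset\Omega^1_{\bar A/\bar W}\otimes\mathrm{Fil}^{i-1}H$. An $F$-crystal $H$ is ordinary if the graded module $\mathrm{gr}_\bullet H_0$ of the conjugate filtration is a free $\bar A_0$-module and $H_0=\mathrm{Fil}_iH_0\oplus\mathrm{Fil}^{i+1}H_0$ for every $i$. An ordinary $F$-crystal has a unique filtration by sub-$F$-crystals $0=U_{-1}\subset U_0\subset U_1\subset\cdots$ with $U_i\otimes_{\bar A}\bar A_0=\mathrm{Fil}_iH_0$ and $U_i/U_{i-1}\simeq V_i(-i)$ for unit $F$-crystals $V_i$; an ordinary Hodge $F$-crystal decomposes as $H=\bigoplus_iH^i$, $H^i=U_i\cap\mathrm{Fil}^iH$. A Hodge $F$-crystal of level $\le N$ is divisible if for some lift of Frobenius $\phi$ one has $F(\phi)\phi^*\mathrm{Fil}^iH\subset p^iH$ for $i=0,\ldots,N$ (if $p>N$ this then holds for every lift). Ordinary CY3 crystals ($p>3$). An ordinary CY3 crystal over $\bar A_0$ is a divisible ordinary Hodge $F$-crystal $\bar H$ of level $3$ over $\bar A_0$ (with filtrations $0\subset\bar U_0\subset\bar U_1\subset\bar U_2\subset\bar U_3=\bar H$ and $\bar H=\mathrm{Fil}^0\bar H\supset\cdots\supset\mathrm{Fil}^3\bar H\supset0$, and $\bar H^i=\bar U_i\cap\mathrm{Fil}^i\bar H$) with a non-degenerate (i.e. perfect over $\bar A$) alternating bilinear form $\langle\,,\,\rangle:\bar H\times\bar H\to\bar A$ such that: $\mathrm{rank}\,\bar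 H^0=\mathrm{rank}\,\bar H^3=1$ and $\mathrm{rank}\,\bar H^1=\mathrm{rank}\,\bar H^2=h$; for all $x,y\in\bar H$ and every lift of Frobenius $\phi$, $\langle\nabla x,y\rangle+\langle x,\nabla y\rangle=d\langle x,y\rangle$ and $\langle F(\phi)\phi^*(x),F(\phi)\phi^*(y)\rangle=p^3\phi(\langle x,y\rangle)$; and $(\mathrm{Fil}^3\bar H)^\perp=\mathrm{Fil}^1\bar H$, $(\mathrm{Fil}^2\bar H)^\perp=\mathrm{Fil}^2\bar H$. By Griffiths transversality $\nabla$ induces an $\bar A$-linear map $T_{\bar A/\bar W}\to\mathrm{Hom}(\bar H^3,\bar H^2)$ (contract $\nabla:\mathrm{Fil}^3\bar H\to\Omega^1\otimes\mathrm{Fil}^2\bar H$ with a derivation and project to $\mathrm{Fil}^2\bar H/\mathrm{Fil}^3\bar H\simeq\bar H^2$; $\mathrm{Fil}^3\bar H=\bar H^3$). Adapted basis. For an ordinary CY3 crystal for which this map is an isomorphism (so $n=h$) there exist, and we fix, an $\bar A$-basis $e_0,\ldots,e_{2h+1}$ of $\bar H$ with $e_0\in\bar H^0$, $e_1,\ldots,e_h\in\bar H^1$, $e_{h+1},\ldots,e_{2h}\in\bar H^2$, $e_{2h+1}\in\bar H^3$, and a matrix $\mathcal T$ over $K^{\mathrm u}[[t_1,\ldots,t_h]]$ such that (blocks of sizes $1,h,h,1$; $I_h$ identity; $\star$ transpose): (i) $(\langle e_i,e_j\rangle)=\begin{pmatrix}0&0&0&-1\\0&0&I_h&0\\0&-I_h&0&0\\1&0&0&0\end{pmatrix}$;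 (ii) the matrix of $\nabla$ is $\mathcal T^{-1}d\mathcal T$; (iii) for every lift of Frobenius $\psi$ the matrix of $F(\psi)\psi^*$ is $\mathcal T^{-1}P\psi(\mathcal T)$, $P=\mathrm{diag}(1,pI_h,p^2I_h,p^3)$; (iv) $\mathcal T=\begin{pmatrix}1&\tau_{23}^\star&0&0\\0&I_h&0&0\\0&0&I_h&\tau_{23}\\0&0&0&1\end{pmatrix}\begin{pmatrix}1&0&-\tau_{13}^\star&Z\\0&I_h&\tau_{12}&\tau_{13}\\0&0&I_h&0\\0&0&0&1\end{pmatrix}$ with $Z,\tau_{23},\tau_{13},\tau_{12}$ of sizes $1\times1,h\times1,h\times1,h\times h$. Columns of matrices give images of basis vectors: $\nabla e_b=\sum_aM_{ab}\otimes e_a$, $F(\psi)\psi^*e_b=\sum_aM_{ab}e_a$. $\psi(\mathcal T)$ is obtained by applying $\sigma$ to coefficients and substituting $\psi(t_i)$ for $t_i$ in the entries (with $p$-adic convergence coefficient by coefficient). Write $\tau_{23}=(\tau_1,\ldots,\tau_h)^\star$. The matrix $(\partial\tau_i/\partial t_j)$ is invertible, and $\frac{\partial}{\partial\tau_i}=\sum_j\frac{\partial t_j}{\partial\tau_i}\frac{\partial}{\partial t_j}$, where $\left(\frac{\partial t_j}{\partial\tau_i}\right)_{j,i}$ is the inverse matrix of $\left(\frac{\partial\tau_i}{\partial t_j}\right)_{i,j}$; $\frac{\partial}{\partial\tau_i}\otimes1$ denotes contraction of the differential-form factor with this derivation. *)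

(* Defs.v *)
From HB Require Import structures.
From mathcomp Require Import all_boot all_order all_algebra.
From mathcomp Require Import boolp classical_sets.
From mathcomp Require Import mpoly.

Set Implicit Arguments.
Unset Strict Implicit.
Unset Printing Implicit Defensive.

Import GRing.Theory.
Local Open Scope ring_scope.
Local Open Scope classical_set_scope.

(* R[[t_1, ..., t_n]]; f m is the coefficient of t^m. *)
Record mps (n : nat) (R : Type) : Type := MPS { mpsc :> 'X_{1..n} -> R }.

HB.instance Definition _ n R := gen_eqMixin (mps n R).
HB.instance Definition _ n R := gen_choiceMixin (mps n R).

Lemma mpsP n R (f g : mps n R) : f =1 g <-> f = g.
Proof. by split=> [/funext|->//]; case: f g => f [g] /= ->. Qed.

Section PowerSeriesRing.
Variables (n : nat) (R : comNzRingType).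
Implicit Types f g h : mps n R.

Definition mpsC (c : R) : mps n R := MPS (fun m => if m == 0%MM then c else 0).
Definition mpsX (j : 'I_n) : mps n R := MPS (fun m => (m == U_(j)%MM)%:R).

Definition mps_add f g : mps n R := MPS (fun m => f m + g m).
Definition mps_opp f : mps n R := MPS (fun m => - f m).
Definition mps_mul f g : mps n R := MPS (fun m =>
  \sum_(k : 'X_{1..n < (mdeg m).+1, (mdeg m).+1} | m == (k.1 + k.2)%MM)
     f k.1 * g k.2).

Fact mps_addA : associative mps_add.
Proof. by move=> f g h; apply/mpsP => m /=; rewrite addrA. Qed.
Fact mps_addC : commutative mps_add.
Proof. by move=> f g; apply/mpsP => m /=; rewrite addrC. Qed.
Fact mps_add0 : left_id (mpsC 0) mps_add.
Proof. by move=> f; apply/mpsP => m /=; rewrite if_same add0r. Qed.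
Fact mps_addN : left_inverse (mpsC 0) mps_opp mps_add.
Proof. by move=> f; apply/mpsP => m /=; rewrite if_same addNr. Qed.

HB.instance Definition _ :=
  GRing.isZmodule.Build (mps n R) mps_addA mps_addC mps_add0 mps_addN.

Let trunc d f : {mpoly R[n]} := \sum_(m : 'X_{1..n < d}) f m *: 'X_[m].

Let truncE d f m : (mdeg m < d)%N -> (trunc d f)@_m = f m.
Proof. exact: mcoeff_mpoly. Qed.

Let eq_mcoeffM (P P' Q Q' : {mpoly R[n]}) m :
  (forall k, (mdeg k <= mdeg m)%N -> P@_k = P'@_k) ->
  (forall k, (mdeg k <= mdeg m)%N -> Q@_k = Q'@_k) ->
  (P * Q)@_m = (P' * Q')@_m.
Proof.
move=> eP eQ; rewrite !mcoeffM; apply: eq_bigr => -[a b] _ /=.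
by rewrite eP ?eQ // -ltnS bmdeg.
Qed.

Let mps_mulE f g m d : (mdeg m < d)%N ->
  mps_mul f g m = (trunc d f * trunc d g)@_m.
Proof.
move=> md; rewrite mcoeffM /=; apply: eq_bigr => -[a b] _ /=.
by rewrite !truncE // (leq_trans _ md) // bmdeg.
Qed.

Fact mps_mulA : associative mps_mul.
Proof.
move=> f g h; apply/mpsP => m; have md := ltnSn (mdeg m).
rewrite !(mps_mulE _ _ md).
transitivity (trunc (mdeg m).+1 f * (trunc (mdeg m).+1 g * trunc (mdeg m).+1 h))@_m.
  by apply: eq_mcoeffM => // k km; rewrite truncE // (@mps_mulE _ _ _ (mdeg m).+1).
rewrite mulrA; apply: eq_mcoeffM => // k km.
by rewrite truncE // (@mps_mulE _ _ _ (mdeg m).+1).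
Qed.

Fact mps_mulC : commutative mps_mul.
Proof.
move=> f g; apply/mpsP => m; have md := ltnSn (mdeg m).
by rewrite !(mps_mulE _ _ md) mulrC.
Qed.

Fact mps_mul1 : left_id (mpsC 1) mps_mul.
Proof.
move=> f; apply/mpsP => m; have md := ltnSn (mdeg m).
rewrite (mps_mulE _ _ md) -[RHS](truncE f md) -[trunc _ f in RHS]mul1r.
apply: eq_mcoeffM => // k km; rewrite truncE //= mcoeff1.
by case: eqP.
Qed.

Fact mps_mulD : left_distributive mps_mul +%R.
Proof.
move=> f g h; apply/mpsP => m /=; rewrite -big_split /=.
by apply: eq_bigr => k _; rewrite mulrDl.
Qed.

Fact mps_one_neq0 : mpsC 1 != 0.
Proof.
by apply/eqP => /mpsP/(_ 0%MM) /=; rewrite eqxx => /eqP; rewrite oner_eq0.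
Qed.

HB.instance Definition _ := GRing.Zmodule_isComNzRing.Build (mps n R)
  mps_mulA mps_mulC mps_mul1 mps_mulD mps_one_neq0.

(* Power series are given the classical unit structure of any commutative ring,
   so that invmx makes sense over them. *)
Definition mps_unit : {pred mps n R} := fun f => `[< exists g, g * f = 1 >].
Definition mps_inv f := if pselect (exists g, g * f = 1) is left ex then xchoose
  (P := fun g => g * f == 1)
  (let: ex_intro g e := ex in ex_intro _ g (introT eqP e)) else f.

Fact mps_mulV : {in mps_unit, left_inverse 1 mps_inv *%R}.
Proof.
move=> f /asboolP ex; rewrite /mps_inv; case: pselect => // ex'.
exact/eqP/(xchooseP (P := fun g => g * f == 1)).
Qed.
Fact mps_unitP f g : g * f = 1 -> mps_unit f.
Proof. by move=> e; apply/asboolP; exists g. Qed.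
Fact mps_inv_out : {in [predC mps_unit], mps_inv =1 id}.
Proof.
by move=> f /negP nu; rewrite /mps_inv; case: pselect => // ex; case: nu; apply/asboolP.
Qed.

HB.instance Definition _ := GRing.ComNzRing_hasMulInverse.Build (mps n R)
  mps_mulV mps_unitP mps_inv_out.

Definition mps_deriv (j : 'I_n) f : mps n R :=
  MPS (fun m => f (m + U_(j))%MM *+ (m j).+1).

End PowerSeriesRing.

Definition mps_map n (R S : Type) (g : R -> S) (f : mps n R) : mps n S :=
  MPS (g \o f).

(* ghost_n(x) = sum_{i <= n} p^i x_i^(p^(n-i)) *)
Definition ghost (p : nat) (R : comNzRingType) (x : nat -> R) (n : nat) : R :=
  \sum_(i < n.+1) x i ^+ (p ^ (n - i)) *+ p ^ i.

(* f is a functorial operation on sequences that becomes op on ghost components.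
   For op = + and op = * there is exactly one such f, given by the Witt
   polynomials. *)
Definition is_witt_op (p : nat) (op : forall R : comNzRingType, R -> R -> R)
    (f : forall R : comNzRingType, (nat -> R) -> (nat -> R) -> nat -> R) : Prop :=
  (forall (R S : comNzRingType) (g : {rmorphism R -> S}) x y,
     g \o f R x y =1 f S (g \o x) (g \o y)) /\
  (forall (R : comNzRingType) x y n,
     ghost p (f R x y) n = op R (ghost p x n) (ghost p y n)).

(* The ring of p-typical Witt vectors of k: sequences over k with the Witt
   addition and multiplication. The integral domain structure is no extra
   hypothesis when k is a perfect field of characteristic p. *)
Record wittRing (p : nat) (k : closedFieldType) := WittRing {
  witt_sort :> idomainType;
  witt_coord : witt_sort -> nat -> k;
  witt_of : (nat -> k) -> witt_sort;
  witt_coordK : cancel witt_coord witt_of;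
  witt_ofK : cancel witt_of witt_coord;
  witt_laws : exists add mul,
    [/\ is_witt_op p (fun R => +%R) add, is_witt_op p (fun R => *%R) mul,
        forall x y, witt_coord (x + y) = add k (witt_coord x) (witt_coord y) &
        forall x y, witt_coord (x * y) = mul k (witt_coord x) (witt_coord y)]
}.

(* The family u sums to s for the topology with basis of neighbourhoods p^N L of
   0 (convergence along the directed set of finite sets of indices). *)
Definition padic_sum (p : nat) (V : zmodType) (L : set V) (I : eqType)
    (u : I -> V) (s : V) : Prop :=
  forall N : nat, exists S0 : seq I, forall S : seq I,
    uniq S -> {subset S0 <= S} ->
    exists2 w, L w & s - \sum_(i <- S) u i = w *+ p ^ N.

Section FreeModules.
Variable A : comNzRingType.

Definition lincomb (M : lmodType A) r (b : 'I_r -> M) (c : 'rV[A]_r) : M :=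
  \sum_i c 0 i *: b i.

Definition is_basis_of (M : lmodType A) (S : set M) r (b : 'I_r -> M) : Prop :=
  injective (lincomb b) /\ range (lincomb b) = S.

Definition free_of_rank (M : lmodType A) (S : set M) (r : nat) : Prop :=
  exists b : 'I_r -> M, is_basis_of S b.

(* B ⊗_{f,A} M for a finitely generated free M, in the coordinates v2r of M;
   bc_map f is x |-> 1 ⊗ x. *)
Definition bc (B : comNzRingType) (f : A -> B) (M : vectType A) : vectType B :=
  'rV[B]_(dim M).

Definition bc_map (B : comNzRingType) (f : A -> B) (M : vectType A) (x : M) :
    bc f M :=
  map_mx f (VectorInternalTheory.v2r x).

(* The quotient a / b, when it exists and is unique. *)
Definition equo (a b : A) : A := xget 0 [set y | b * y = a].

End FreeModules.

Section Crystals.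
Variables (p : nat) (k : closedFieldType) (W : wittRing p k) (n : nat).

Definition sigma (w : W) : W := witt_of W (fun i => witt_coord w i ^+ p).

(* W[1/p] is the fraction field of W, since p generates the maximal ideal of W. *)
Definition Ku : fieldType := {fraction W}.

Definition sigmaK (x : Ku) : Ku :=
  tofrac (sigma (frac (repr x)).1) / tofrac (sigma (frac (repr x)).2).

Definition A : comUnitRingType := mps n W.
Definition A0 : comUnitRingType := mps n k.
Definition KT : comUnitRingType := mps n Ku.

Definition t (j : 'I_n) : A := mpsX W j.
Definition red : A -> A0 := mps_map (fun w => witt_coord w 0).
Definition toKT : A -> KT := mps_map (@tofrac W).

Record frob_lift := FrobLift {
  fl_fun :> {rmorphism A -> A};
  fl_sigma : forall w : W, fl_fun (mpsC n w) = mpsC n (sigma w);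
  fl_red : forall a : A, red (fl_fun a) = red a ^+ p
}.

(* Omega^1_{A/W} is 'rV[A]_n in the basis dt_j, and Omega^1 ⊗ M is
   {ffun 'I_n -> M}: the element sum_j dt_j ⊗ h_j is [ffun j => h_j].
   A derivation sum_j v_j d/dt_j is the row vector v. *)
Definition dA (a : A) : 'rV[A]_n := \row_j mps_deriv j a.

Definition otimes (M : lmodType A) (w : 'rV[A]_n) (x : M) : {ffun 'I_n -> M} :=
  [ffun j => w 0 j *: x].

Definition contract (M : lmodType A) (v : 'rV[A]_n) (w : {ffun 'I_n -> M}) : M :=
  \sum_j v 0 j *: w j.

(* phi ⊗ Phi on Omega^1 ⊗ M, where phi(dt_j) = d(phi(t_j)). *)
Definition phi_otimes (M : lmodType A) (phi : frob_lift) (Phi : M -> M)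
    (w : {ffun 'I_n -> M}) : {ffun 'I_n -> M} :=
  \sum_j otimes (dA (phi (t j))) (Phi (w j)).

Record fcrystal_data := FcrystalData {
  fc_mod :> vectType A;
  nabla : fc_mod -> {ffun 'I_n -> fc_mod};
  frob : forall phi : frob_lift, bc phi fc_mod -> fc_mod
}.

Definition covD (X : fcrystal_data) (j : 'I_n) (x : X) : X := nabla x j.

(* D_1^{m_1} o ... o D_n^{m_n} *)
Definition covDpow (X : fcrystal_data) (m : 'X_{1..n}) (x : X) : X :=
  foldr (fun j => iter (m j) (@covD X j)) x (enum 'I_n).

(* F(phi) phi^* : X -> X *)
Definition Fphi (X : fcrystal_data) (phi : frob_lift) (x : X) : X :=
  frob (bc_map phi x).

Definition chi_coef (phi psi : frob_lift) (m : 'X_{1..n}) : A :=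
  \prod_j (equo (p ^ m j)%:R (m j)`!%:R
            * equo (phi (t j) - psi (t j)) p%:R ^+ m j).

Definition is_chi (X : fcrystal_data) (phi psi : frob_lift)
    (chi : bc phi X -> bc psi X) : Prop :=
  linear chi /\
  forall x : X, padic_sum p setT
    (fun m : 'X_{1..n} => chi_coef phi psi m *: bc_map psi (covDpow m x))
    (chi (bc_map phi x)).

Record is_crystal (X : fcrystal_data) : Prop := IsCrystal {
  nablaD : forall x y : X, nabla (x + y) = nabla x + nabla y;
  nabla_leibniz : forall (a : A) (x : X),
    nabla (a *: x) = otimes (dA a) x + a *: nabla x;
  covDC : forall i j (x : X), covD i (covD j x) = covD j (covD i x);
  covD_nil : forall (j : 'I_n) (N : nat), exists M : nat, forall m : nat,
    (M <= m)%N -> exists g : X -> X,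
      (forall (c : W) x y, g (mpsC n c *: x + y) = mpsC n c *: g x + g y) /\
      forall x, iter m (@covD X j) x = g x *+ p ^ N
}.

Record is_fcrystal (X : fcrystal_data) : Prop := IsFcrystal {
  fc_crystal : is_crystal X;
  frob_linear : forall phi : frob_lift, linear (@frob X phi);
  frob_horizontal : forall (phi : frob_lift) (x : X),
    nabla (Fphi phi x) = phi_otimes phi (@Fphi X phi) (nabla x);
  frob_chi : forall phi psi : frob_lift, exists chi : bc phi X -> bc psi X,
    is_chi chi /\ forall u, frob (chi u) = frob u;
  (* F(phi)[1/p] is injective and surjective *)
  frob_inj : forall (phi : frob_lift) (u : bc phi X),
    (exists m, frob u *+ p ^ m = 0) -> exists m, u *+ p ^ m = 0;
  frob_surj : forall (phi : frob_lift) (y : X),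
    exists m (u : bc phi X), frob u = y *+ p ^ m
}.

Definition is_unit_fcrystal (X : fcrystal_data) : Prop :=
  is_fcrystal X /\ exists phi : frob_lift, bijective (@frob X phi).

(* X(-i) *)
Definition tate_twist (X : fcrystal_data) (i : nat) : fcrystal_data :=
  @FcrystalData X (@nabla X) (fun phi u => frob u *+ p ^ i).

Definition fc_hom (X Y : fcrystal_data) (f : X -> Y) : Prop :=
  [/\ linear f,
      forall x, nabla (f x) = [ffun j => f (nabla x j)] &
      forall phi x, Fphi phi (f x) = f (Fphi phi x)].

Section Filtrations.
Variable X : fcrystal_data.

Definition H0 : vectType A0 := bc red X.

(* Both filtrations of H0 are independent of phi. *)
Definition conj_fil (i : nat) : set H0 :=
  [set x | exists (phi : frob_lift) (y : X),
     bc_map red y = x /\ exists u : bc phi X, y *+ p ^ i = frob u].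

Definition hodge_fil (i : nat) : set H0 :=
  [set x | exists (phi : frob_lift) (y : X),
     bc_map red y = x /\ exists z : X, Fphi phi y = z *+ p ^ i].

(* The step of index i - 1 of an increasing filtration starting from 0 *)
Definition prev_step (V : zmodType) (G : nat -> set V) (i : nat) : set V :=
  if i is i'.+1 then G i' else [set 0].

Definition level_le (N : nat) : Prop :=
  conj_fil N = setT /\ hodge_fil N.+1 = [set 0].

(* S is a free submodule of X and S ⊗_A A0 -> H0 is an isomorphism onto S0: a
   basis of S reduces to a basis of S0. *)
Definition reduces_to (S : set X) (S0 : set H0) : Prop :=
  exists (r : nat) (b : 'I_r -> X),
    is_basis_of S b /\ is_basis_of S0 (fun i => bc_map red (b i)).

Record is_hodge_fcrystal (Fil : nat -> set X) : Prop := IsHodgeFcrystal {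
  hf_fcrystal : is_fcrystal X;
  hf_0 : Fil 0 = setT;
  hf_decr : forall i, Fil i.+1 `<=` Fil i;
  hf_red : forall i, reduces_to (Fil i) (hodge_fil i);
  hf_transversal : forall i x, Fil i x -> forall j, Fil i.-1 (nabla x j)
}.

Record is_ordinary : Prop := IsOrdinary {
  ord_fcrystal : is_fcrystal X;
  ord_gr_free : forall i, exists (r : nat) (b : 'I_r -> H0),
    (forall a, conj_fil i (b a)) /\
    forall x, conj_fil i x ->
      exists! c : 'rV[A0]_r, prev_step conj_fil i (x - lincomb b c);
  ord_sum : forall i (x : H0), exists y z,
    [/\ conj_fil i y, hodge_fil i.+1 z & x = y + z];
  ord_direct : forall i, conj_fil i `&` hodge_fil i.+1 = [set 0]
}.

(* The filtration U_i of an ordinary F-crystal: U_i is the image of an injective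
   morphism from an F-crystal Y, and q induces U_i / U_{i-1} ~ V(-i). *)
Definition is_slope_filtration (U : nat -> set X) : Prop :=
  forall i,
    [/\ prev_step U i `<=` U i,
        reduces_to (U i) (conj_fil i) &
        exists (Y : fcrystal_data) (j : Y -> X),
          [/\ is_fcrystal Y, fc_hom j, injective j, range j = U i &
              exists (V : fcrystal_data) (q : Y -> tate_twist V i),
                [/\ is_unit_fcrystal V, fc_hom q, range q = setT &
                    forall y, q y = 0 <-> prev_step U i (j y)]]].

Definition is_divisible (N : nat) (Fil : nat -> set X) : Prop :=
  level_le N /\
  exists phi : frob_lift, forall i, (i <= N)%N ->
    forall x, Fil i x -> exists z, Fphi phi x = z *+ p ^ i.

Definition perp (pair : X -> X -> A) (S : set X) : set X :=
  [set y | forall x, S x -> pair x y = 0].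

Definition Hcomp (Fil U : nat -> set X) (i : nat) : set X := U i `&` Fil i.

Record is_ordinary_CY3 (h : nat) (Fil U : nat -> set X) (pair : X -> X -> A) :
    Prop := IsOrdinaryCY3 {
  cy_hodge : is_hodge_fcrystal Fil;
  cy_ordinary : is_ordinary;
  cy_slope : is_slope_filtration U;
  cy_divisible : is_divisible 3 Fil;
  cy_Fil4 : Fil 4 = [set 0];
  cy_U3 : U 3 = setT;
  cy_rank0 : free_of_rank (Hcomp Fil U 0) 1;
  cy_rank1 : free_of_rank (Hcomp Fil U 1) h;
  cy_rank2 : free_of_rank (Hcomp Fil U 2) h;
  cy_rank3 : free_of_rank (Hcomp Fil U 3) 1;
  cy_pairDl : forall a x x' y, pair (a *: x + x') y = a * pair x y + pair x' y;
  cy_pairDr : forall a x y y', pair x (a *: y + y') = a * pair x y + pair x y';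
  cy_alternating : forall x, pair x x = 0;
  cy_perfect : forall f : {scalar X}, exists! x, pair x =1 f;
  cy_pair_nabla : forall x y j,
    pair (nabla x j) y + pair x (nabla y j) = dA (pair x y) 0 j;
  cy_pair_frob : forall (phi : frob_lift) x y,
    pair (Fphi phi x) (Fphi phi y) = phi (pair x y) *+ p ^ 3;
  cy_perp3 : perp pair (Fil 3) = Fil 1;
  cy_perp2 : perp pair (Fil 2) = Fil 2
}.

(* The map T_{A/W} -> Hom(H^3, H^2) sending v to
   x |-> (v ⊗ 1)(nabla x) mod Fil^3, with Fil^2 / Fil^3 identified with H^2, is
   bijective: every g in Hom(H^3, H^2) comes from exactly one v. *)
Definition KS_bijective (Fil U : nat -> set X) : Prop :=
  let H3 := Hcomp Fil U 3 in let H2 := Hcomp Fil U 2 in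
  forall g : X -> X,
    (forall a x y, H3 x -> H3 y -> g (a *: x + y) = a *: g x + g y) ->
    (forall x, H3 x -> H2 (g x)) ->
    exists! v : 'rV[A]_n, forall x, H3 x -> Fil 3 (contract v (nabla x) - g x).

End Filtrations.

(* g = psi(f): sigma on the coefficients of f and psi(t_j) for t_j, each
   coefficient of the result being a p-adically convergent sum in Ku. *)
Definition is_subst (psi : frob_lift) (f g : KT) : Prop :=
  forall l : 'X_{1..n}, padic_sum p (range (@tofrac W))
    (fun m : 'X_{1..n} =>
       sigmaK (f m) * tofrac ((\prod_j psi (t j) ^+ m j : A) l))
    (g l).

Section Blocks.
Variables (R : comNzRingType) (h : nat).

Definition mx4 (a00 : 'M[R]_1) (a01 a02 : 'M[R]_(1, h)) (a03 : 'M[R]_1)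
    (a10 : 'M[R]_(h, 1)) (a11 a12 : 'M[R]_h) (a13 : 'M[R]_(h, 1))
    (a20 : 'M[R]_(h, 1)) (a21 a22 : 'M[R]_h) (a23 : 'M[R]_(h, 1))
    (a30 : 'M[R]_1) (a31 a32 : 'M[R]_(1, h)) (a33 : 'M[R]_1) :
    'M[R]_(1 + (h + (h + 1))) :=
  col_mx (row_mx a00 (row_mx a01 (row_mx a02 a03)))
 (col_mx (row_mx a10 (row_mx a11 (row_mx a12 a13)))
 (col_mx (row_mx a20 (row_mx a21 (row_mx a22 a23)))
         (row_mx a30 (row_mx a31 (row_mx a32 a33))))).

Definition gram_mx : 'M[R]_(1 + (h + (h + 1))) :=
  mx4 0 0     0    (-1)
      0 0     1%:M 0
      0 (- 1%:M) 0 0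
      1 0     0    0.

Definition P_mx (p : nat) : 'M[R]_(1 + (h + (h + 1))) :=
  mx4 1 0        0                0
      0 (p%:R%:M) 0               0
      0 0        ((p ^ 2)%:R%:M)  0
      0 0        0                ((p ^ 3)%:R%:M).

Definition T_mx (tau12 : 'M[R]_h) (tau13 tau23 : 'cV[R]_h) (Z : R) :
    'M[R]_(1 + (h + (h + 1))) :=
  mx4 1 tau23^T 0    0
      0 1%:M    0    0
      0 0       1%:M tau23
      0 0       0    1
  *m
  mx4 1 0    (- tau13^T) Z%:M
      0 1%:M tau12       tau13
      0 0    1%:M        0
      0 0    0           1.

Definition idx0 : 'I_(1 + (h + (h + 1))) := lshift _ ord0.
Definition idx1 (i : 'I_h) : 'I_(1 + (h + (h + 1))) := rshift 1 (lshift _ i).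
Definition idx2 (i : 'I_h) : 'I_(1 + (h + (h + 1))) :=
  rshift 1 (rshift h (lshift 1 i)).
Definition idx3 : 'I_(1 + (h + (h + 1))) := rshift 1 (rshift h (rshift h ord0)).

End Blocks.

Record is_adapted_basis (h : nat) (X : fcrystal_data) (Fil U : nat -> set X)
    (pair : X -> X -> A) (e : 'I_(1 + (h + (h + 1))) -> X)
    (tau12 : 'M[KT]_h) (tau13 tau23 : 'cV[KT]_h) (Z : KT) : Prop :=
  IsAdaptedBasis {
  ab_basis : is_basis_of setT e;
  ab_H0 : Hcomp Fil U 0 (e (idx0 h));
  ab_H1 : forall i, Hcomp Fil U 1 (e (idx1 i));
  ab_H2 : forall i, Hcomp Fil U 2 (e (idx2 i));
  ab_H3 : Hcomp Fil U 3 (e (idx3 h));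
  ab_gram : \matrix_(a, b) pair (e a) (e b) = gram_mx A h;
  ab_nabla : exists N : 'I_n -> 'M[A]_(1 + (h + (h + 1))),
    (forall b, nabla (e b) = \sum_a otimes (\row_j N j a b) (e a)) /\
    forall j, map_mx toKT (N j) =
      invmx (T_mx tau12 tau13 tau23 Z)
      *m map_mx (mps_deriv j) (T_mx tau12 tau13 tau23 Z);
  ab_frob : forall psi : frob_lift,
    exists (N : 'M[A]_(1 + (h + (h + 1)))) (psiT : 'M[KT]_(1 + (h + (h + 1)))),
    [/\ forall b, Fphi psi (e b) = \sum_a N a b *: e a,
        forall a b, is_subst psi (T_mx tau12 tau13 tau23 Z a b) (psiT a b) &
        map_mx toKT N = invmx (T_mx tau12 tau13 tau23 Z) *m P_mx KT h p *m psiT]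
}.

Definition jacobian (h : nat) (tau : 'cV[KT]_h) : 'M[KT]_(h, n) :=
  \matrix_(i, j) mps_deriv j (tau i 0).

(* For G = (dt_j/dtau_i)_{j,i}: the derivation d/dtau_i of KT, and the operator
   (d/dtau_i ⊗ 1) o nabla. *)
Definition dtau (h : nat) (G : 'M[A]_(n, h)) (i : 'I_h) (f : KT) : KT :=
  \sum_j toKT (G j i) * mps_deriv j f.

Definition nabla_dtau (h : nat) (X : fcrystal_data) (G : 'M[A]_(n, h))
    (i : 'I_h) (x : X) : X :=
  contract (\row_j G j i) (nabla x).

End Crystals.

(* Main.v *)
(** Write [D_j = d/dt_j] and [v = tau23].  Griffiths transversality, read through
    the pairing, kills the entries of [T^-1 dT] in the blocks (0,3), (1,3) and
    (0,2), that is
      dZ = -2 tau13^* dv,   dtau13 = tau12 dv,   dtau13^* = dv^* tau12.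
    Hence, along the dual derivations [d/dtau_i], nabla moves [e_3] to the [e_2]'s,
    these to the [e_1]'s with coefficients [d tau12], and these to [e_0]; the left
    side is [d tau12_il / dtau_j].  The right side is [d tau12_lj / dtau_i].  The two
    agree because [tau12] is symmetric and, differentiating [dtau13 = tau12 dv] once
    more, [d tau12_la / dtau_b] is symmetric in [a] and [b].  The bijectivity of the
    Kodaira-Spencer map says exactly that the Jacobian of [v], which is the (2,3) block
    of the matrix of nabla and so has entries in [A], is invertible over [A]. *)

Require Import Defs.
From HB Require Import structures.
From mathcomp Require Import all_boot all_order all_algebra.
From mathcomp Require Import boolp classical_sets.
From mathcomp Require Import mpoly.

Set Implicit Arguments.
Unset Strict Implicit.
Unset Printing Implicit Defensive.

Import GRing.Theory.
Local Open Scope ring_scope.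
Local Open Scope classical_set_scope.

(** * Derivations of power series *)

Section PowerSeriesDerivation.
Variables (n : nat) (R : comNzRingType).
Implicit Types f g : mps n R.

Definition mps_trunc d f : {mpoly R[n]} := \sum_(m : 'X_{1..n < d}) f m *: 'X_[m].

Lemma mcoeff_mps_trunc d f m : (mdeg m < d)%N -> (mps_trunc d f)@_m = f m.
Proof. exact: mcoeff_mpoly. Qed.

(** Coefficients of products are computed on polynomial truncations, where [mderivM] already
    provides the Leibniz rule. *)
Lemma mps_mulE f g m d : (mdeg m < d)%N ->
  (f * g) m = (mps_trunc d f * mps_trunc d g)@_m.
Proof.
move=> md; rewrite mcoeffM; apply: eq_bigr => -[a b] _ /=.
by rewrite !mcoeff_mps_trunc // (leq_trans _ md) // bmdeg.
Qed.

Fact mps_deriv_zmod_morphism j : zmod_morphism (@mps_deriv n R j).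
Proof. by move=> f g; apply/mpsP => m /=; rewrite mulrnDl mulNrn. Qed.

HB.instance Definition _ j := GRing.isZmodMorphism.Build (mps n R) (mps n R)
  (@mps_deriv n R j) (mps_deriv_zmod_morphism j).

Lemma mps_derivMNn j f d : mps_deriv j (f *- d) = mps_deriv j f *- d.
Proof. exact: raddfMNn. Qed.

Lemma mcoeff_mderiv_trunc j d f m : (mdeg m < d)%N ->
  ((mps_trunc d.+1 f)^`M(j))@_m = mps_deriv j f m.
Proof. by move=> md; rewrite mcoeff_deriv mcoeff_mps_trunc // mdegD mdeg1 addn1. Qed.

Lemma mps_derivM j f g :
  mps_deriv j (f * g) = mps_deriv j f * g + f * mps_deriv j g.
Proof.
(* The derivative reads the coefficient at [m + U_(j)], one degree higher; hence the truncation at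
   [(mdeg m).+2]. *)
apply/mpsP => m; have md : (mdeg (m + U_(j)) < (mdeg m).+2)%N.
  by rewrite mdegD mdeg1 addn1.
transitivity ((f * g) (m + U_(j))%MM *+ (m j).+1) => [//|].
transitivity ((mps_deriv j f * g) m + (f * mps_deriv j g) m) => [|//].
rewrite (mps_mulE f g md) -mcoeff_deriv mderivM mcoeffD.
rewrite !(@mps_mulE _ _ m (mdeg m).+2) //; congr (_ + _);
  rewrite !mcoeffM; apply: eq_bigr => -[a b] _ /=; have := (bmdeg a, bmdeg b);
  by case=> ? ?; rewrite mcoeff_mderiv_trunc // !mcoeff_mps_trunc // ltnW.
Qed.

Lemma mps_derivC i j f : mps_deriv i (mps_deriv j f) = mps_deriv j (mps_deriv i f).
Proof.
apply/mpsP => m /=; rewrite -!mulrnA -!addmA [(U_(i) + _)%MM]addmC; congr (_ *+ _).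
rewrite !mnmDE !mnm1E [j == i]eq_sym; case: eqP => [->|_] //.
by rewrite !addn0 mulnC.
Qed.

Lemma mps_deriv1 j : mps_deriv j (1 : mps n R) = 0.
Proof.
have := mps_derivM j 1 1; rewrite !mulr1 mul1r => /(canLR (addrK _)).
by rewrite subrr.
Qed.

Lemma map_mps_derivM j q r s (M : 'M[mps n R]_(q, r)) (N : 'M[mps n R]_(r, s)) :
  map_mx (mps_deriv j) (M *m N)
  = map_mx (mps_deriv j) M *m N + M *m map_mx (mps_deriv j) N.
Proof.
apply/matrixP => a b; rewrite !mxE raddf_sum -big_split.
by apply: eq_bigr => c _; rewrite !mxE; exact: mps_derivM.
Qed.

End PowerSeriesDerivation.

(** * The matrix of the connection *)

Section Mx4.
Variables (R : comNzRingType) (h : nat).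

Definition mulmx4 q r (x0 : 'M[R]_(q, 1)) (x1 x2 : 'M[R]_(q, h)) (x3 : 'M[R]_(q, 1))
    (y0 : 'M[R]_(1, r)) (y1 y2 : 'M[R]_(h, r)) (y3 : 'M[R]_(1, r)) : 'M[R]_(q, r) :=
  x0 *m y0 + (x1 *m y1 + (x2 *m y2 + x3 *m y3)).

Lemma mul_mx4 (a00 b00 : 'M[R]_1) (a01 a02 b01 b02 : 'M[R]_(1, h)) (a03 b03 : 'M[R]_1)
    (a10 b10 : 'M[R]_(h, 1)) (a11 a12 b11 b12 : 'M[R]_h) (a13 b13 : 'M[R]_(h, 1))
    (a20 b20 : 'M[R]_(h, 1)) (a21 a22 b21 b22 : 'M[R]_h) (a23 b23 : 'M[R]_(h, 1))
    (a30 b30 : 'M[R]_1) (a31 a32 b31 b32 : 'M[R]_(1, h)) (a33 b33 : 'M[R]_1) :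
  mx4 a00 a01 a02 a03 a10 a11 a12 a13 a20 a21 a22 a23 a30 a31 a32 a33
  *m mx4 b00 b01 b02 b03 b10 b11 b12 b13 b20 b21 b22 b23 b30 b31 b32 b33 =
  mx4 (mulmx4 a00 a01 a02 a03 b00 b10 b20 b30) (mulmx4 a00 a01 a02 a03 b01 b11 b21 b31)
      (mulmx4 a00 a01 a02 a03 b02 b12 b22 b32) (mulmx4 a00 a01 a02 a03 b03 b13 b23 b33)
      (mulmx4 a10 a11 a12 a13 b00 b10 b20 b30) (mulmx4 a10 a11 a12 a13 b01 b11 b21 b31)
      (mulmx4 a10 a11 a12 a13 b02 b12 b22 b32) (mulmx4 a10 a11 a12 a13 b03 b13 b23 b33)
      (mulmx4 a20 a21 a22 a23 b00 b10 b20 b30) (mulmx4 a20 a21 a22 a23 b01 b11 b21 b31)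
      (mulmx4 a20 a21 a22 a23 b02 b12 b22 b32) (mulmx4 a20 a21 a22 a23 b03 b13 b23 b33)
      (mulmx4 a30 a31 a32 a33 b00 b10 b20 b30) (mulmx4 a30 a31 a32 a33 b01 b11 b21 b31)
      (mulmx4 a30 a31 a32 a33 b02 b12 b22 b32) (mulmx4 a30 a31 a32 a33 b03 b13 b23 b33).
Proof.
by rewrite /mx4 !mul_col_mx !mul_row_col !mul_mx_row !add_row_mx.
Qed.

Lemma mx4_1 : mx4 1 0 0 0 0 1%:M 0 0 0 0 1%:M 0 0 0 0 1 = 1%:M :> 'M[R]_(1 + (h + (h + 1))).
Proof.
rewrite !scalar_mx_block /block_mx /mx4.
have E q r s (X : 'M[R]_(q, s)) (Y : 'M[R]_(r, s)) d :
    row_mx (0 : 'M[R]_(q + r, d)) (col_mx X Y) = col_mx (row_mx 0 X) (row_mx 0 Y).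
  by rewrite -col_mx0 -block_mxEh.
by rewrite !row_mx0 !E.
Qed.

Definition block_simpl := (mul0mx, mulmx0, mul1mx, mulmx1, add0r, addr0).

Lemma T_mxE (S : 'M[R]_h) (u v : 'cV[R]_h) (z : R) :
  T_mx S u v z =
  mx4 1 v^T (v^T *m S - u^T) (z%:M + v^T *m u)
      0 1%:M S u
      0 0 1%:M v
      0 0 0 1.
Proof.
by rewrite /T_mx mul_mx4 /mulmx4 !block_simpl [- _ + _]addrC.
Qed.

End Mx4.

(** Both factors have the form [1 + E] with [E] of square zero, so [1 - E], the matrix [B], is the
    inverse. *)
Lemma T_mx_unit (R : comUnitRingType) h (S : 'M[R]_h) (u v : 'cV[R]_h) (z : R) :
  T_mx S u v z \in unitmx.
Proof.
rewrite /T_mx unitmx_mul; apply/andP; split.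
  pose B := mx4 1 (- v^T) 0 0 0 1%:M 0 0 0 0 1%:M (- v) 0 0 0 1.
  suff /mulmx1_unit[] : mx4 1 v^T 0 0 0 1%:M 0 0 0 0 1%:M v 0 0 0 1 *m B = 1%:M by [].
  by rewrite mul_mx4 /mulmx4 !block_simpl addNr addrC subrr mx4_1.
pose B := mx4 1 0 u^T (- z%:M) 0 1%:M (- S) (- u) 0 0 1%:M 0 0 0 0 1.
suff /mulmx1_unit[] : mx4 1 0 (- u^T) z%:M 0 1%:M S u 0 0 1%:M 0 0 0 0 1 *m B = 1%:M by [].
by rewrite mul_mx4 /mulmx4 !block_simpl subrr !addNr mx4_1.
Qed.

Section NablaMatrix.
Variables (n : nat) (R : comNzRingType) (h : nat).
Notation K := (mps n R).
Variables (S : 'M[K]_h) (u v : 'cV[K]_h) (z : K) (j : 'I_n).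
Local Notation D := (mps_deriv j).
Local Notation "M ^D" := (map_mx D M) (at level 2).

Lemma map_mps_deriv1 m : (1%:M : 'M[K]_m)^D = 0.
Proof.
by apply/matrixP => a b; rewrite !mxE; case: eqP => _; rewrite ?mps_deriv1 ?raddf0.
Qed.

(** The second factor is the closed form of [T^-1 dT]; keeping [T_mx] on the left avoids expanding
    its inverse. *)
Lemma T_mx_deriv :
  T_mx S u v z *m
  mx4 0 (v^D)^T ((v^D)^T *m S - (u^D)^T) ((D z)%:M + ((v^D)^T *m u + u^T *m v^D))
      0 0 S^D (u^D - S *m v^D)
      0 0 0 v^D
      0 0 0 0
  = (T_mx S u v z)^D.
Proof.
have Dz : (z%:M : 'M_1)^D = (D z)%:M.
  by apply/matrixP => a b; rewrite !mxE !ord1 raddfMn.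
rewrite !T_mxE mul_mx4 /mulmx4 !block_simpl [in RHS]/mx4 !map_col_mx !map_row_mx.
rewrite !map_mx0 !map_mxD !map_mxN !map_mps_derivM !map_mps_deriv1 /= Dz -!map_trmx.
(* In block (0,3) the terms [u^T *m v^D] and [v^T *m S *m v^D] cancel, which leaves the Leibniz rule
   for [v^T *m u]. *)
rewrite subrK addrAC mulmxBr mulmxBl mulmxA [_ - _ + (_ - _)]addrA subrK.
by rewrite -[_ + _ + (_ - _)]addrA addrACA subrr addr0.
Qed.

End NablaMatrix.

(** * Differentiation in the coordinates tau *)

Section FlatCoordinates.
Variables (n : nat) (R : comNzRingType) (h : nat).
Local Notation K := (mps n R).
Variables (S : 'M[K]_h) (u v : 'cV[K]_h) (z : K) (G : 'M[K]_(n, h)).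
Local Notation D := (@mps_deriv n R).
Local Notation dG i f := (\sum_j G j i * D j f).

Hypothesis dGv : forall a i, dG i (v a 0) = (a == i)%:R.

(** By [dGv] the derivations [dG l] are dual to the forms [dv_a], so contracting a combination of
    these forms returns its coefficient. *)
Lemma chain_sum (c : 'I_h -> K) l :
  \sum_j G j l * (\sum_a c a * D j (v a 0)) = c l.
Proof.
transitivity (\sum_a c a * dG l (v a 0)).
  under eq_bigr do rewrite mulr_sumr.
  rewrite exchange_big; apply: eq_bigr => a _; rewrite mulr_sumr.
  by apply: eq_bigr => j _; rewrite mulrCA.
rewrite (bigD1 l) //= dGv eqxx mulr1 big1 ?addr0 // => a /negPf al.
by rewrite dGv al mulr0.
Qed.

Lemma chain_rule (f : K) (c : 'I_h -> K) l :
  (forall j, D j f = \sum_a c a * D j (v a 0)) -> dG l f = c l.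
Proof. by move=> fE; rewrite -[RHS]chain_sum; under eq_bigr do rewrite fE. Qed.

Hypothesis dz : forall j, D j z = \sum_a - (u a 0 *+ 2) * D j (v a 0).
Hypothesis du : forall j l, D j (u l 0) = \sum_a S l a * D j (v a 0).
Hypothesis du' : forall j l, D j (u l 0) = \sum_a S a l * D j (v a 0).

(** [du] and [du'] evaluate the same derivative [dG i (u l 0)], as [S l i] and as [S i l]. *)
Lemma chain_rule_sym i l : S i l = S l i.
Proof. by rewrite -(chain_rule i (du^~ l)) -(chain_rule i (du'^~ l)). Qed.

(* Equality of the mixed derivatives [D_b D_c u_l]. *)
Lemma dS_sym i j l : dG i (S l j) = dG j (S l i).
Proof.
(* Leibniz applied to [du] also yields second derivatives of [v]; they agree on both sides and
   cancel. *)
have DDu b c : \sum_a D c (S l a) * D b (v a 0) = \sum_a D b (S l a) * D c (v a 0).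
  have : D c (D b (u l 0)) = D b (D c (u l 0)) by rewrite mps_derivC.
  rewrite !du !raddf_sum /=.
  under eq_bigr do rewrite mps_derivM.
  under [X in _ = X -> _]eq_bigr do rewrite mps_derivM mps_derivC.
  by rewrite !big_split /= => /addIr.
(* It remains to write [d(S l i)] as a combination of the [dv_a] with coefficients [dG i (S l a)]:
   [chain_sum] introduces a contraction with [dG i], and [DDu] moves that derivation onto [S]. *)
rewrite [RHS](@chain_rule _ (fun a => dG i (S l a))) // => b.
rewrite -[LHS](chain_sum (fun a => D b (S l a))).
under eq_bigr do rewrite DDu mulr_sumr.
rewrite exchange_big; apply: eq_bigr => a _; rewrite mulr_suml.
by apply: eq_bigr => c _; rewrite mulrA.
Qed.

(** The successive derivatives are [-2 u_l] by [dz], then [-2 S_lj] by [du]; [dS_sym] and the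
    symmetry of [S] bring the third to the form that the pairing produces. *)
Lemma dG3_z i j l : dG i (dG j (dG l z)) = - dG j (S i l) *+ 2.
Proof.
rewrite (chain_rule l dz).
have -> : dG j (- (u l 0 *+ 2)) = - (S l j *+ 2).
  rewrite -(chain_rule j (du^~ l)) -sumrMnl -sumrN.
  by apply: eq_bigr => a _; rewrite mps_derivMNn mulrN mulrnAr.
rewrite [S i l]chain_rule_sym -(dS_sym i j) mulNrn -sumrMnl -sumrN.
by apply: eq_bigr => a _; rewrite mps_derivMNn mulrN mulrnAr.
Qed.

End FlatCoordinates.

(** * Integral series inside [KT], and integers in the Witt ring *)

Section IntegralSeries.
Variables (p : nat) (k : closedFieldType) (W : wittRing p k) (n : nat).

Lemma toKT_zmod_morphism : zmod_morphism (@toKT p k W n).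
Proof. by move=> f g; apply/mpsP => m /=; rewrite tofracB. Qed.

Lemma toKT_monoid_morphism : monoid_morphism (@toKT p k W n).
Proof.
split; first by apply/mpsP => m /=; case: ifP => _; rewrite ?tofrac0 ?tofrac1.
move=> f g; apply/mpsP => m /=; rewrite raddf_sum /=.
by apply: eq_bigr => i _; rewrite tofracM.
Qed.

HB.instance Definition _ := GRing.isZmodMorphism.Build (A W n) (KT W n)
  (@toKT p k W n) toKT_zmod_morphism.
HB.instance Definition _ := GRing.isMonoidMorphism.Build (A W n) (KT W n)
  (@toKT p k W n) toKT_monoid_morphism.

Lemma toKT_inj : injective (@toKT p k W n).
Proof.
move=> f g /mpsP fg; apply/mpsP => m; apply/eqP; rewrite -tofrac_eq; apply/eqP.
exact: fg.
Qed.

(* The zeroth ghost component is the zeroth coordinate, so [x |-> x_0] is a ring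
   homomorphism [W -> k]. *)
Lemma witt_op0 op f (R : comNzRingType) (x y : nat -> R) :
  is_witt_op p op f -> f R x y 0%N = op R (x 0%N) (y 0%N).
Proof.
by case=> _ /(_ R x y 0%N); rewrite /ghost !big_ord1 !subn0 !expn0 !expr1 !mulr1n.
Qed.

(** An integer that vanishes in [W] has zeroth coordinate 0. The case [m = 2] will allow division by
    2 in [Ku]. *)
Lemma witt_nat_neq0 m : m%:R != 0 :> k -> m%:R != 0 :> W.
Proof.
have [add [mul [addP mulP addE mulE]]] := witt_laws W.
pose f (w : W) := witt_coord w 0%N.
have fD x y : f (x + y) = f x + f y by rewrite /f addE (witt_op0 _ _ addP).
have fM x y : f (x * y) = f x * f y by rewrite /f mulE (witt_op0 _ _ mulP).
have f0 : f 0 = 0 by apply: (addrI (f 0)); rewrite -fD !addr0.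
(* The coordinates of 1 are not given; the zeroth one comes from [1 * w = w] for a [w] whose zeroth
   coordinate is 1. *)
have f1 : f 1 = 1.
  by have := fM 1 (witt_of W (fun=> 1)); rewrite mul1r /f !witt_ofK mulr1 => <-.
have fn : f m%:R = m%:R by elim: m => // m IH; rewrite !mulrS fD IH f1.
by apply: contra_neq => m0; rewrite -fn m0 f0.
Qed.

End IntegralSeries.

(** * Entries of block matrices and sums over the four blocks *)

Section BlockEntries.
Variables (R : comNzRingType) (h : nat).

(** A product of equations serves as a multirule, so that one [rewrite] reads off any entry. *)
Lemma mx4E (a00 : 'M[R]_1) (a01 a02 : 'M[R]_(1, h)) (a03 : 'M[R]_1)
    (a10 : 'M[R]_(h, 1)) (a11 a12 : 'M[R]_h) (a13 : 'M[R]_(h, 1))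
    (a20 : 'M[R]_(h, 1)) (a21 a22 : 'M[R]_h) (a23 : 'M[R]_(h, 1))
    (a30 : 'M[R]_1) (a31 a32 : 'M[R]_(1, h)) (a33 : 'M[R]_1)
    (M := mx4 a00 a01 a02 a03 a10 a11 a12 a13 a20 a21 a22 a23 a30 a31 a32 a33) :
  (
    ((M (idx0 h) (idx0 h) = a00 0 0) * (forall j, M (idx0 h) (idx1 j) = a01 0 j)
     * (forall j, M (idx0 h) (idx2 j) = a02 0 j) * (M (idx0 h) (idx3 h) = a03 0 0))
  * ((forall i, M (idx1 i) (idx0 h) = a10 i 0) * (forall i j, M (idx1 i) (idx1 j) = a11 i j)
     * (forall i j, M (idx1 i) (idx2 j) = a12 i j) * (forall i, M (idx1 i) (idx3 h) = a13 i 0))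
  * ((forall i, M (idx2 i) (idx0 h) = a20 i 0) * (forall i j, M (idx2 i) (idx1 j) = a21 i j)
     * (forall i j, M (idx2 i) (idx2 j) = a22 i j) * (forall i, M (idx2 i) (idx3 h) = a23 i 0))
  * ((M (idx3 h) (idx0 h) = a30 0 0) * (forall j, M (idx3 h) (idx1 j) = a31 0 j)
     * (forall j, M (idx3 h) (idx2 j) = a32 0 j) * (M (idx3 h) (idx3 h) = a33 0 0)))%type.
Proof.
rewrite {}/M /mx4 /idx0 /idx1 /idx2 /idx3; do ![split];
  by move=> *; rewrite !(col_mxEu, col_mxEd, row_mxEl, row_mxEr).
Qed.

Lemma sum_idx (V : nmodType) (F : 'I_(1 + (h + (h + 1))) -> V) :
  \sum_a F a = F (idx0 h) + (\sum_i F (idx1 i) + (\sum_i F (idx2 i) + F (idx3 h))).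
Proof. by rewrite !big_split_ord /= !big_ord1. Qed.

End BlockEntries.

(** * Subsets spanned by a basis *)

Section FreeSpans.
Variables (A : comNzRingType) (M : lmodType A).

Lemma lincombP r (b : 'I_r -> M) a c d :
  lincomb b (a *: c + d) = a *: lincomb b c + lincomb b d.
Proof.
rewrite /lincomb scaler_sumr -big_split /=; apply: eq_bigr => i _.
by rewrite !mxE scalerDl scalerA.
Qed.

(** The steps of the filtrations are bare sets; their submodule structure is recovered from a
    basis. *)
Lemma is_basis_of_linear (T : set M) r (b : 'I_r -> M) a x y :
  is_basis_of T b -> T x -> T y -> T (a *: x + y).
Proof.
move=> [_ <-] [c _ <-] [d _ <-]; exists (a *: c + d) => //; exact: lincombP.
Qed.

Lemma is_basis_of0 (T : set M) r (b : 'I_r -> M) : is_basis_of T b -> T 0.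
Proof.
by move=> [_ <-]; exists 0 => //; rewrite /lincomb big1 // => i _; rewrite mxE scale0r.
Qed.

End FreeSpans.

(** * Consequences of Griffiths transversality *)

Section AdaptedBasis.
Variables (p : nat) (k : closedFieldType) (W : wittRing p k).
Variables (n h : nat) (X : fcrystal_data W n) (Fil U : nat -> set X).
Variable pair : X -> X -> A W n.
Hypothesis cyX : is_ordinary_CY3 h Fil U pair.

Lemma pairDr x y z : pair x (y + z) = pair x y + pair x z.
Proof. by have := cy_pairDr cyX 1 x y z; rewrite scale1r mul1r. Qed.

Lemma pair0r x : pair x 0 = 0.
Proof. by apply: (addrI (pair x 0)); rewrite -pairDr !addr0. Qed.

Lemma pairZr a x y : pair x (a *: y) = a * pair x y.
Proof. by have := cy_pairDr cyX a x y 0; rewrite pair0r !addr0. Qed.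

Lemma pair_sumr I (r : seq I) P x (F : I -> X) :
  pair x (\sum_(i <- r | P i) F i) = \sum_(i <- r | P i) pair x (F i).
Proof. exact: (big_morph (pair x) (pairDr x) (pair0r x)). Qed.

Lemma pair_anti x y : pair y x = - pair x y.
Proof.
have pairDl u v w : pair (u + v) w = pair u w + pair v w.
  by have := cy_pairDl cyX 1 u v w; rewrite scale1r mul1r.
have := cy_alternating cyX (x + y); rewrite pairDr !pairDl !(cy_alternating cyX).
by rewrite add0r addr0 => /eqP; rewrite addr_eq0 => /eqP.
Qed.

Lemma nablaZ a (x : X) j : nabla (a *: x) j = mps_deriv j a *: x + a *: nabla x j.
Proof.
have cr := fc_crystal (hf_fcrystal (cy_hodge cyX)).
by rewrite (nabla_leibniz cr) !ffunE mxE.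
Qed.

Lemma nabla_sum I (r : seq I) P (F : I -> X) j :
  nabla (\sum_(i <- r | P i) F i : X) j = \sum_(i <- r | P i) nabla (F i) j.
Proof.
have cr := fc_crystal (hf_fcrystal (cy_hodge cyX)).
have nD (x y : X) : nabla (x + y) j = nabla x j + nabla y j by rewrite (nablaD cr) ffunE.
apply: (big_morph (fun x : X => nabla x j) nD).
by apply: (addrI (nabla (0 : X) j)); rewrite -nD !addr0.
Qed.

Variable e : 'I_(1 + (h + (h + 1))) -> X.
Hypothesis gramE : \matrix_(a, b) pair (e a) (e b) = gram_mx (A W n) h.
Hypothesis e_gen : range (lincomb e) = setT.
Hypothesis e2_Fil : forall i, Fil 2 (e (idx2 i)).
Hypothesis e3_Fil : Fil 3 (e (idx3 h)).
Hypothesis e1_Fil : forall i, Fil 1 (e (idx1 i)).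

(** The Gram matrix makes [e] its own dual basis up to order and sign, so pairings read off
    coordinates. *)
Lemma pair_lincomb (c : 'I_(1 + (h + (h + 1))) -> A W n) :
  let x := \sum_a c a *: e a in
  [/\ pair (e (idx0 h)) x = - c (idx3 h),
      forall i, pair (e (idx1 i)) x = c (idx2 i),
      forall i, pair (e (idx2 i)) x = - c (idx1 i) &
      pair (e (idx3 h)) x = c (idx0 h)].
Proof.
move=> x; have pE a : pair (e a) x = \sum_b c b * gram_mx (A W n) h a b.
  rewrite /x pair_sumr; apply: eq_bigr => b _.
  by rewrite pairZr -gramE mxE.
split=> [|i|i|]; rewrite pE sum_idx /gram_mx !mx4E.
- do 2 (rewrite big1; last by move=> j _; rewrite mx4E mxE mulr0).
  by rewrite !mxE mulr0 mulrN1 !add0r.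
- rewrite big1; last by move=> j _; rewrite mx4E mxE mulr0.
  rewrite (bigD1 i) //= big1 => [|j ji]; last first.
    by rewrite mx4E !mxE eq_sym (negPf ji) mulr0.
  by rewrite mx4E !mxE eqxx !mulr0 mulr1 !add0r !addr0.
- rewrite (bigD1 i) //= big1 => [|j ji]; last first.
    by rewrite mx4E !mxE eq_sym (negPf ji) oppr0 mulr0.
  rewrite big1; last by move=> j _; rewrite mx4E mxE mulr0.
  by rewrite mx4E !mxE eqxx !mulr0 mulrN1 !add0r !addr0.
- do 2 (rewrite big1; last by move=> j _; rewrite mx4E mxE mulr0).
  by rewrite !mxE mulr0 mulr1 !addr0.
Qed.

(* [Fil 1], [Fil 2], [Fil 3] are orthogonal to [e_3], the [e_2]'s, the [e_1]'s. *)
Lemma coord_eq0 (c : 'I_(1 + (h + (h + 1))) -> A W n) (x := \sum_a c a *: e a) :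
  [/\ Fil 1 x -> c (idx0 h) = 0,
      Fil 2 x -> forall i, c (idx1 i) = 0 &
      Fil 3 x -> forall i, c (idx2 i) = 0].
Proof.
have [_ c2E c1E c0E] := pair_lincomb c; split=> [|Fx i|Fx i].
- by rewrite -(cy_perp3 cyX) => /(_ _ e3_Fil); rewrite c0E.
- apply: oppr_inj; rewrite oppr0 -c1E.
  by move: Fx; rewrite -{1}(cy_perp2 cyX); apply.
- rewrite -c2E pair_anti.
  by have := e1_Fil i; rewrite -(cy_perp3 cyX) => ->; rewrite ?oppr0.
Qed.

Variables (tau12 : 'M[KT W n]_h) (tau13 tau23 : 'cV[KT W n]_h) (Z : KT W n).
Variable N : 'I_n -> 'M[A W n]_(1 + (h + (h + 1))).
Hypothesis nablaE : forall b, nabla (e b) = \sum_a otimes (\row_j N j a b) (e a).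
Hypothesis NE : forall j, map_mx (@toKT p k W n) (N j) =
  invmx (T_mx tau12 tau13 tau23 Z)
  *m map_mx (mps_deriv j) (T_mx tau12 tau13 tau23 Z).
Local Notation D := (@mps_deriv n (Ku W)).

Lemma nabla_eE b j : nabla (e b) j = \sum_a N j a b *: e a.
Proof. by rewrite nablaE sum_ffunE; apply: eq_bigr => a _; rewrite ffunE mxE. Qed.

Let vD j := map_mx (D j) tau23.
Let uD j := map_mx (D j) tau13.

(** [T_mx] is invertible and cancels in [T_mx_deriv]. Zeros found here descend to [A], since [toKT]
    is injective. *)
Lemma toKT_N j a b : toKT (N j a b) =
  mx4 0 (vD j)^T ((vD j)^T *m tau12 - (uD j)^T)
        ((D j Z)%:M + ((vD j)^T *m tau13 + tau13^T *m vD j))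
      0 0 (map_mx (D j) tau12) (uD j - tau12 *m vD j)
      0 0 0 (vD j)
      0 0 0 0 a b.
Proof.
have := NE j; rewrite -T_mx_deriv mulKmx ?T_mx_unit // => /matrixP/(_ a b).
by rewrite mxE.
Qed.

Let J := \matrix_(i < h, j < n) N j (idx2 i) (idx3 h).

Lemma toKT_J : map_mx (@toKT p k W n) J = jacobian tau23.
Proof. by apply/matrixP => i j; rewrite !mxE toKT_N mx4E mxE. Qed.

Lemma toKT_eq0 (f : A W n) : toKT f = 0 -> f = 0.
Proof. by move=> f0; apply: toKT_inj; rewrite f0 raddf0. Qed.

Lemma Fil_decr i x : Fil i.+1 x -> Fil i x.
Proof. exact: (hf_decr (cy_hodge cyX)). Qed.

(** Transversality puts [nabla e_3] in [Fil 2] and the [nabla e_2] in [Fil 1], and [coord_eq0] kills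
    the coordinates. *)
Lemma N_griffiths j : [/\ N j (idx0 h) (idx3 h) = 0,
  forall i, N j (idx1 i) (idx3 h) = 0 & forall i, N j (idx0 h) (idx2 i) = 0].
Proof.
have F3 : Fil 2 (nabla (e (idx3 h)) j).
  exact: (hf_transversal (cy_hodge cyX) (i := 3)).
have F2 i : Fil 1 (nabla (e (idx2 i)) j).
  exact: (hf_transversal (cy_hodge cyX) (i := 2)).
split=> [|i|i].
- have [+ _ _] := coord_eq0 (fun a => N j a (idx3 h)); apply.
  by rewrite -nabla_eE; apply: Fil_decr.
- by have [_ + _] := coord_eq0 (fun a => N j a (idx3 h)); apply; rewrite -nabla_eE.
- by have [+ _ _] := coord_eq0 (fun a => N j a (idx2 i)); apply; rewrite -nabla_eE.
Qed.

Lemma nabla_e3 j : nabla (e (idx3 h)) j = \sum_i J i j *: e (idx2 i).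
Proof.
have [N03 N13 _] := N_griffiths j.
have N33 : N j (idx3 h) (idx3 h) = 0 by apply: toKT_eq0; rewrite toKT_N mx4E mxE.
rewrite nabla_eE sum_idx N03 N33 !scale0r add0r addr0.
rewrite big1 ?add0r => [|i _]; last by rewrite N13 scale0r.
by apply: eq_bigr => i _; rewrite mxE.
Qed.

Lemma nabla_e2 i j : nabla (e (idx2 i)) j = \sum_a N j (idx1 a) (idx2 i) *: e (idx1 a).
Proof.
have [_ _ N02] := N_griffiths j.
have N32 : N j (idx3 h) (idx2 i) = 0 by apply: toKT_eq0; rewrite toKT_N mx4E mxE.
rewrite nabla_eE sum_idx N02 N32 !scale0r add0r addr0.
rewrite [X in _ + X]big1 ?addr0 // => a _.
by rewrite [N _ _ _]toKT_eq0 ?scale0r // toKT_N mx4E mxE.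
Qed.

(** The matrix [J] of [nabla_e3] reappears because [tau23] enters [T_mx] twice: block (0,1) of the
    connection is the transpose of block (2,3). *)
Lemma nabla_e1 i j : nabla (e (idx1 i)) j = J i j *: e (idx0 h).
Proof.
have N31 : N j (idx3 h) (idx1 i) = 0 by apply: toKT_eq0; rewrite toKT_N mx4E mxE.
rewrite nabla_eE sum_idx N31 !scale0r addr0.
rewrite big1 ?add0r => [|a _]; last first.
  by rewrite [N _ _ _]toKT_eq0 ?scale0r // toKT_N mx4E mxE.
rewrite big1 ?addr0 => [|a _]; last first.
  by rewrite [N _ _ _]toKT_eq0 ?scale0r // toKT_N mx4E mxE.
by congr (_ *: _); apply: toKT_inj; rewrite mxE !toKT_N !mx4E mxE.
Qed.

(** Vanishing of block (0,3). Its two products are transposes of each other, and equal as scalars;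
    hence the factor 2. *)
Lemma deriv_Z j : D j Z = \sum_a - (tau13 a 0 *+ 2) * D j (tau23 a 0).
Proof.
have [N03 _ _] := N_griffiths j.
have := congr1 (@toKT p k W n) N03.
rewrite raddf0 toKT_N mx4E !mxE eqxx mulr1n -big_split /=.
move=> /eqP; rewrite addr_eq0 => /eqP ->; rewrite -sumrN; apply: eq_bigr => a _.
by rewrite !mxE mulNr mulrnAl mulr2n [D _ _ * _]mulrC.
Qed.

Lemma deriv_tau13 j l : D j (tau13 l 0) = \sum_a tau12 l a * D j (tau23 a 0).
Proof.
have [_ N13 _] := N_griffiths j.
have := congr1 (@toKT p k W n) (N13 l); rewrite raddf0 toKT_N mx4E !mxE.
by move=> /eqP; rewrite subr_eq0 => /eqP ->; apply: eq_bigr => a _; rewrite mxE.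
Qed.

(** Block (0,2) gives the transpose of the relation from block (1,3); comparing the two yields the
    symmetry of [tau12]. *)
Lemma deriv_tau13' j l : D j (tau13 l 0) = \sum_a tau12 a l * D j (tau23 a 0).
Proof.
have [_ _ N02] := N_griffiths j.
have := congr1 (@toKT p k W n) (N02 l); rewrite raddf0 toKT_N mx4E !mxE.
by move=> /eqP; rewrite subr_eq0 => /eqP <-; apply: eq_bigr => a _; rewrite !mxE mulrC.
Qed.

Lemma Fil3E x : Fil 3 x -> x = - pair (e (idx0 h)) x *: e (idx3 h).
Proof.
have [c _ <-] : range (lincomb e) x by rewrite e_gen.
move=> F3x; have [c0 c1 c2] := coord_eq0 (c 0).
have [-> _ _ _] := pair_lincomb (c 0); rewrite opprK.
have F2x := Fil_decr F3x; have F1x := Fil_decr F2x.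
rewrite /lincomb sum_idx c0 // scale0r add0r.
rewrite big1 ?add0r => [|a _]; last by rewrite c1 ?scale0r.
by rewrite big1 ?add0r => [|a _]; last by rewrite c2 ?scale0r.
Qed.

(** * The Kodaira-Spencer map and invertibility of the Jacobian *)

Hypothesis ks : KS_bijective Fil U.
Hypothesis e2_H : forall i, Hcomp Fil U 2 (e (idx2 i)).

(** The column [w] encodes the map from [H^3] to [H^2] that sends [e_3] to the combination of the
    [e_2]'s with coefficients [w]; in these coordinates the Kodaira-Spencer map is [J]. *)
Lemma KS_coord (w : 'cV[A W n]_h) : exists! v : 'cV[A W n]_n, J *m v = w.
Proof.
have U3 x : U 3 x by rewrite (cy_U3 cyX).
(* [- pair e_0 x] is the coordinate of [x] on [e_3]. *)
pose g x := - pair (e (idx0 h)) x *: \sum_i w i 0 *: e (idx2 i).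
have g_lin a x y : Hcomp Fil U 3 x -> Hcomp Fil U 3 y -> g (a *: x + y) = a *: g x + g y.
  by rewrite /g pairDr pairZr opprD scalerDl -mulrN scalerA.
have g_H2 x : Hcomp Fil U 3 x -> Hcomp Fil U 2 (g x).
  have [b bP] := cy_rank2 cyX => _; rewrite -[g x]addr0.
  apply: (is_basis_of_linear _ bP) (is_basis_of0 bP).
  apply: (big_ind (Hcomp Fil U 2)) => [|y z Hy Hz|i _]; first exact: (is_basis_of0 bP).
    by have := is_basis_of_linear 1 bP Hy Hz; rewrite scale1r.
  rewrite -[_ *: _]addr0; exact: (is_basis_of_linear _ bP) (e2_H i) (is_basis_of0 bP).
have ge3 : g (e (idx3 h)) = \sum_i w i 0 *: e (idx2 i).
  have -> : e (idx3 h) = \sum_a (a == idx3 h)%:R *: e a.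
    rewrite (bigD1 (idx3 h)) //= eqxx scale1r big1 ?addr0 // => a /negPf ->.
    by rewrite scale0r.
  rewrite /g; have [-> _ _ _] := pair_lincomb (fun a => (a == idx3 h)%:R).
  by rewrite eqxx opprK scale1r.
have solve v : J *m v^T = w <->
    forall x, Hcomp Fil U 3 x -> Fil 3 (contract v (nabla x) - g x).
  have ctr : contract v (nabla (e (idx3 h))) = \sum_i (J *m v^T) i 0 *: e (idx2 i).
    rewrite /contract; under eq_bigr do rewrite nabla_e3 scaler_sumr.
    rewrite exchange_big; apply: eq_bigr => i _; rewrite mxE scaler_suml.
    by apply: eq_bigr => j _; rewrite scalerA !mxE mulrC.
  split=> [Jv x [_ F3x]|/(_ (e (idx3 h)))]; last first.
    rewrite ge3 ctr => /(_ (conj (U3 _) e3_Fil)).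
    (* A combination of the [e_2]'s lying in [Fil 3] is orthogonal to each [e_1] in [Fil 1], so its
       coefficients vanish. *)
    rewrite -sumrB => F3; apply/colP => i; apply/eqP; rewrite -subr_eq0; apply/eqP.
    have := e1_Fil i; rewrite -(cy_perp3 cyX) => /(_ _ F3)/eqP.
    rewrite pair_anti oppr_eq0 pair_sumr => /eqP <-.
    rewrite (bigD1 i) //= big1 ?addr0 => [|a ai]; rewrite -scalerBl pairZr.
      have /matrixP/(_ (idx1 i) (idx2 i)) := gramE.
      by rewrite mxE /gram_mx mx4E mxE eqxx => ->; rewrite mulr1.
    have /matrixP/(_ (idx1 i) (idx2 a)) := gramE; rewrite mxE /gram_mx mx4E mxE eq_sym.
    by rewrite (negPf ai) => ->; rewrite mulr0.
  have [r [b [bP _]]] := hf_red (cy_hodge cyX) 3.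
  rewrite {1}(Fil3E F3x); set c := - pair _ _.
  (* The Leibniz term is a multiple of [e_3], hence in [Fil 3]: modulo [Fil 3] the contraction is
     linear. *)
  have -> : contract v (nabla (c *: e (idx3 h)))
      = (\sum_j v 0 j * mps_deriv j c) *: e (idx3 h) + c *: contract v (nabla (e (idx3 h))).
    rewrite /contract scaler_suml scaler_sumr -big_split; apply: eq_bigr => j _.
    by rewrite nablaZ scalerDr !scalerA [c * _]mulrC.
  rewrite ctr Jv -addrA subrr addr0 -[_ *: _]addr0.
  exact: (is_basis_of_linear _ bP) e3_Fil (is_basis_of0 bP).
have [v [vP vU]] := ks g_lin g_H2; exists v^T; split; first exact/solve.
by move=> v'; rewrite -[v' in J *m v']trmxK => /solve/vU ->; rewrite trmxK.
Qed.

(** Existence in [KS_coord] gives a right inverse column by column. As [J] is not known to be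
    square, uniqueness supplies the left inverse: the columns of [G *m J] and of the identity solve
    the same systems. *)
Lemma KS_inverse : exists G : 'M[A W n]_(n, h), G *m J = 1%:M /\ J *m G = 1%:M.
Proof.
have /choice[s sP] : forall i : 'I_h, exists v, J *m v = col i 1%:M.
  by move=> i; have [v [vP _]] := KS_coord (col i 1%:M); exists v.
pose G := \matrix_(j, i) s i j 0.
have JG : J *m G = 1%:M.
  apply/matrixP => a i; have /matrixP/(_ a 0) := sP i; rewrite !mxE => <-.
  by apply: eq_bigr => j _; rewrite !mxE.
exists G; split=> //; apply/matrixP => a j.
have [v [_ vU]] := KS_coord (col j J).
have GJ : J *m col j (G *m J) = col j J by rewrite !colE !mulmxA JG mul1mx.
have J1 : J *m col j 1%:M = col j J by rewrite !colE mul1mx.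
by have /matrixP/(_ a 0) := etrans (esym (vU _ GJ)) (vU _ J1); rewrite !mxE.
Qed.

Lemma pair_nabla_dtau3 (G : 'M[A W n]_(n, h)) i j l : J *m G = 1%:M ->
  toKT (pair (e (idx3 h)) (nabla_dtau G i (nabla_dtau G j (nabla_dtau G l (e (idx3 h))))))
  = dtau G j (tau12 i l).
Proof.
move=> JG; have JGE a b : \sum_c G c b * J a c = (a == b)%:R.
  have /matrixP/(_ a b) := JG; rewrite !mxE => <-.
  by apply: eq_bigr => c _; rewrite mulrC.
have -> : nabla_dtau G l (e (idx3 h)) = e (idx2 l).
  rewrite /nabla_dtau /contract; under eq_bigr do rewrite mxE nabla_e3 scaler_sumr.
  rewrite exchange_big (bigD1 l) //= [X in _ + X]big1 => [|a al].
    under eq_bigr do rewrite scalerA.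
    by rewrite -scaler_suml JGE eqxx scale1r addr0.
  under eq_bigr do rewrite scalerA.
  by rewrite -scaler_suml JGE (negPf al) scale0r.
pose s a := \sum_c G c j * N c (idx1 a) (idx2 l).
have -> : nabla_dtau G j (e (idx2 l)) = \sum_a s a *: e (idx1 a).
  rewrite /nabla_dtau /contract; under eq_bigr do rewrite mxE nabla_e2 scaler_sumr.
  rewrite exchange_big; apply: eq_bigr => a _; rewrite scaler_suml.
  by apply: eq_bigr => c _; rewrite scalerA.
have e31 a : pair (e (idx3 h)) (e (idx1 a)) = 0.
  by have /matrixP/(_ (idx3 h) (idx1 a)) := gramE; rewrite mxE /gram_mx mx4E mxE.
have e30 : pair (e (idx3 h)) (e (idx0 h)) = 1.
  by have /matrixP/(_ (idx3 h) (idx0 h)) := gramE; rewrite mxE /gram_mx mx4E mxE.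
have -> : pair (e (idx3 h)) (nabla_dtau G i (\sum_a s a *: e (idx1 a))) = s i.
  transitivity (\sum_c G c i * (\sum_a s a * J a c)).
    rewrite pair_sumr; apply: eq_bigr => c _.
    rewrite mxE pairZr nabla_sum pair_sumr; congr (_ * _); apply: eq_bigr => a _.
    (* The Leibniz terms, multiples of the [e_1]'s, are orthogonal to [e_3], so no derivative of [s]
       survives. *)
    by rewrite nablaZ pairDr !pairZr e31 mulr0 add0r nabla_e1 pairZr e30 mulr1.
  under eq_bigr do rewrite mulr_sumr.
  rewrite exchange_big (bigD1 i) //= [X in _ + X]big1 => [|a ai].
    under eq_bigr do rewrite mulrCA.
    by rewrite -mulr_sumr JGE eqxx mulr1 addr0.
  under eq_bigr do rewrite mulrCA.
  by rewrite -mulr_sumr JGE (negPf ai) mulr0.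
rewrite raddf_sum; apply: eq_bigr => c _.
by rewrite /= rmorphM /= toKT_N mx4E mxE.
Qed.

End AdaptedBasis.

Theorem corollary2p3 (p : nat) (p_prime : prime p) (p_gt3 : (3 < p)%N)
    (k : closedFieldType) (k_char : p \in [pchar k]) (W : wittRing p k)
    (n h : nat) (H : fcrystal_data W n) (Fil U : nat -> set H)
    (pair : H -> H -> A W n)
    (cyH : is_ordinary_CY3 h Fil U pair)
    (ks : KS_bijective Fil U)
    (e : 'I_(1 + (h + (h + 1))) -> H)
    (tau12 : 'M[KT W n]_h) (tau13 tau23 : 'cV[KT W n]_h) (Z : KT W n)
    (adapted : is_adapted_basis Fil U pair e tau12 tau13 tau23 Z) :
  exists G : 'M[A W n]_(n, h),
    [/\ map_mx (@toKT p k W n) G *m jacobian tau23 = 1%:M,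
        jacobian tau23 *m map_mx (@toKT p k W n) G = 1%:M &
        forall i j l : 'I_h,
          toKT (pair (e (idx3 h))
                  (nabla_dtau G i (nabla_dtau G j (nabla_dtau G l (e (idx3 h))))))
          = - mpsC n (2%:R^-1) * dtau G i (dtau G j (dtau G l Z))].
Proof.
have [[e_inj e_gen] _ e1_H e2_H [_ e3_F] gramE [N [nablaE NE]] _] := adapted.
have e2_F i : Fil 2 (e (idx2 i)) by have [] := e2_H i.
have e1_F i : Fil 1 (e (idx1 i)) by have [] := e1_H i.
have toJ := toKT_J NE.
have [G [GJ JG]] := KS_inverse cyH gramE e_gen e2_F e3_F e1_F nablaE NE ks e2_H.
exists G; split.
- by rewrite -toJ -map_mxM GJ map_mx1.
- by rewrite -toJ -map_mxM JG map_mx1.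
move=> i j l.
rewrite (pair_nabla_dtau3 cyH gramE e2_F e3_F e1_F nablaE NE _ _ _ JG).
pose G' := map_mx (@toKT p k W n) G.
have dtauE a f : dtau G a f = \sum_c G' c a * mps_deriv c f.
  by apply: eq_bigr => c _; rewrite mxE.
have dGv a b : \sum_c G' c b * mps_deriv c (tau23 a 0) = (a == b)%:R.
  have /(congr1 (map_mx (@toKT p k W n)))/matrixP/(_ a b) := JG.
  rewrite map_mxM toJ map_mx1 !mxE => <-.
  by apply: eq_bigr => c _; rewrite !mxE mulrC.
rewrite !dtauE (dG3_z dGv (deriv_Z cyH gramE e2_F e3_F e1_F nablaE NE)
  (deriv_tau13 cyH gramE e2_F e3_F e1_F nablaE NE)
  (deriv_tau13' cyH gramE e2_F e3_F e1_F nablaE NE)).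
(* The factor -1/2 meets the -2 of [dG3_z], so only the invertibility of 2 is left. *)
set x := \sum_c _; suff C2 : mpsC n (2%:R^-1 : Ku W) *+ 2 = 1.
  by rewrite mulNrn mulNr mulrN opprK mulrnAr -mulrnAl C2 mul1r.
have two_neq0 : 2%:R != 0 :> Ku W.
  (* Since [p > 3], [p] does not divide 2, so 2 is nonzero in [k], hence in [W] and in its fraction
     field. *)
  rewrite -tofrac1 -tofracMn tofrac_eq0 witt_nat_neq0 // -(dvdn_pcharf k_char).
  by rewrite gtnNdvd // ltnW.
rewrite mulr2n; apply/mpsP => m /=; case: ifP => _; rewrite ?addr0 //.
by rewrite -mulr2n -[LHS]mulr_natr mulVf.
Qed.
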